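(* Let $m,n\ge1$ be integers. Then $|\mathrm{sPF}(K_{m+1,n})|=|\mathrm{sPF}(K_{n+1,m})|$. More generally, for all integers $a,b\ge1$, \[ |\mathrm{sPF}(K_{m+1,n}^{a,b})|=|\mathrm{sPF}(K_{n+1,m}^{a,b})|. \]
   Context: $\mathbb{N}=\{0,1,2,\dots\}$, $[N]=\{1,\dots,N\}$. $K_{m+1,n}$ is the complete bipartite graph on $\{0,1,\dots,m\}\sqcup\{m+1,\dots,m+n\}$ with root $0$ (in the part of size $m+1$). $K_{m+1,n}^{a,b}$ is the complete bipartite multigraph on the same vertex set, with root $0$, having $a$ edges between $0$ and each $j\in\{m+1,\dots,m+n\}$ and $b$ edges between each $i\in\{1,\dots,m\}$ and each $j\in\{m+1,\dots,m+n\}$ (and no other edges). $K_{n+1,m}$, $K_{n+1,m}^{a,b}$ are obtained by exchanging the roles of $m$ and $n$ (root $0$ in the part of size $n+1$). Spherical parking functions: let $G$ be an undirected loopless (multi)graph on $V=\{0,1,\dots,N\}$, $N\ge 2$, with root $0$ and $a_{ij}$ edges between $i$ and $j$ (here $N=m+n$). Let $R=\mathbb{K}[x_1,\dots,x_N]$ over a field $\mathbb{K}$. For $\emptyset\ne A\subseteq[N]$ put $d_A(i)=\sum_{j\in V\setminus A}a_{ij}$ and $m_A=\prod_{i\in A}x_i^{d_A(i)}$. Let $\mathcal{M}_G=\langle m_A:\emptyset\neq A\subseteq[N]\rangle$ and $\mathcal{M}_G^{(k)}=\langle m_A:\emptyset\ne A\subseteq[N],\ |A|\le k+1\rangle$.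 Then $\mathrm{sPF}(G)=\{\mathcal{P}\in\mathbb{N}^N:\ \mathbf{x}^{\mathcal{P}}\in\mathcal{M}_G\setminus\mathcal{M}_G^{(N-2)}\}$. *)

(* Defs.v *)
From HB Require Import structures.
From mathcomp Require Import all_boot all_order all_algebra.
From mathcomp Require Import boolp classical_sets functions cardinality.
From mathcomp Require Import mpoly.

Set Implicit Arguments.
Unset Strict Implicit.
Unset Printing Implicit Defensive.

Import GRing.Theory.

Local Open Scope classical_set_scope.
Local Open Scope ring_scope.

(* Undirected loopless multigraph on the vertices 0, ..., N, rooted at 0;
   [mult i j] is the number of edges between i and j. *)
Record multigraph (N : nat) := Multigraph {
  mult :> 'I_N.+1 -> 'I_N.+1 -> nat;
  mult_sym : forall i j, mult i j = mult j i;
  mult_loopless : forall i, mult i i = 0%N }.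

(* The non-root vertices 1, ..., N index the variables. The type 'I_N numbers
   variables from 0, so that i : 'I_N stands for the vertex i + 1. *)
Definition vertex (N : nat) (i : 'I_N) : 'I_N.+1 := lift ord0 i.

Definition dA (N : nat) (G : multigraph N) (A : {set 'I_N}) (i : 'I_N) : nat :=
  (\sum_(v : 'I_N.+1 | v \notin @vertex N @: A) G (vertex i) v)%N.

Definition mA (K : fieldType) (N : nat) (G : multigraph N) (A : {set 'I_N}) :
  {mpoly K[N]} := \prod_(i in A) 'X_i ^+ dA G A i.

Definition gen_ideal (R : comNzRingType) (I : finType) (P : pred I)
  (g : I -> R) : set R := [set p | exists c : I -> R, p = \sum_(i | P i) c i * g i].

Definition ideal_M (K : fieldType) (N : nat) (G : multigraph N) :
  set {mpoly K[N]} := gen_ideal (fun A : {set 'I_N} => A != finset.set0) (mA K G).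

Arguments ideal_M K {N} G _.

Definition ideal_Mk (K : fieldType) (N : nat) (G : multigraph N) (k : nat) :
  set {mpoly K[N]} :=
  gen_ideal (fun A : {set 'I_N} => (A != finset.set0) && (#|A| <= k + 1)%N) (mA K G).

Arguments ideal_Mk K {N} G k _.

Definition sPF (K : fieldType) (N : nat) (G : multigraph N) : set 'X_{1..N} :=
  [set P | (ideal_M K G `\` ideal_Mk K G (N - 2)) 'X_[P]].

(* [complete_bipartite_multi m n a b] is K_{m+1,n}^{a,b} and
   [complete_bipartite m n] is K_{m+1,n}: the parts are {0, ..., m}, which
   contains the root, and {m+1, ..., m+n}. *)
Definition bip_mult (m n a b : nat) (i j : 'I_(m + n).+1) : nat :=
  if (i <= m)%N == (j <= m)%N then 0%N
  else if (i == ord0) || (j == ord0) then a else b.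

Lemma bip_mult_sym m n a b (i j : 'I_(m + n).+1) :
  bip_mult a b i j = bip_mult a b j i.
Proof. by rewrite /bip_mult eq_sym orbC. Qed.

Lemma bip_mult_loopless m n a b (i : 'I_(m + n).+1) : bip_mult a b i i = 0%N.
Proof. by rewrite /bip_mult eqxx. Qed.

Definition complete_bipartite_multi (m n a b : nat) : multigraph (m + n) :=
  Multigraph (@bip_mult_sym m n a b) (@bip_mult_loopless m n a b).

Definition bip_adj (m n : nat) (i j : 'I_(m + n).+1) : nat := ((i <= m)%N != (j <= m)%N).

Lemma bip_adj_sym m n (i j : 'I_(m + n).+1) : bip_adj i j = bip_adj j i.
Proof. by rewrite /bip_adj eq_sym. Qed.

Lemma bip_adj_loopless m n (i : 'I_(m + n).+1) : bip_adj i i = 0%N.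
Proof. by rewrite /bip_adj eqxx. Qed.

Definition complete_bipartite (m n : nat) : multigraph (m + n) :=
  Multigraph (@bip_adj_sym m n) (@bip_adj_loopless m n).

(* For N >= 2 the generators [mA K G [set i]], pure powers of the variables, lie
   in [ideal_Mk K G (N - 2)]; hence equipotence [#=] of two sets [sPF] is
   equality of two natural numbers. *)
Lemma finite_sPF (K : fieldType) (N : nat) (G : multigraph N) :
  (2 <= N)%N -> finite_set (sPF K G).
Proof.
move=> N2.
pose M := (\max_(i < N) dA G [set i]%SET i)%N.
have sub : sPF K G `<=`
    (fun f : {ffun 'I_N -> 'I_M.+1} => [multinom (f i : nat) | i < N]) @` setT.
  move=> P [_ nP].
  have lt_P (i : 'I_N) : (P i < dA G [set i]%SET i)%N.
    rewrite ltnNge; apply/negP => le_P; apply: nP.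
    exists (fun A => if A == [set i]%SET
      then 'X_[P - U_(i) *+ dA G [set i]%SET i] else 0).
    rewrite (bigD1 [set i]%SET) /=; last first.
      rewrite cards1 addn1 ltnS leq0n andbT.
      by apply/set0Pn; exists i; rewrite finset.in_set1.
    rewrite eqxx big1 => [|A /andP[_ /negbTE ->]]; last by rewrite mul0r.
    rewrite addr0 /mA finset.big_set1 mpolyXn -mpolyXD submK //.
    apply/mnm_lepP => j; rewrite mulmnE mnm1E.
    by case: eqP => [<-|_]; rewrite ?mul1n ?mul0n.
  have lt_M i : (P i < M.+1)%N.
    by rewrite ltnS (leq_trans (ltnW (lt_P i))) //
      (leq_bigmax (F := fun i => dA G [set i]%SET i)).
  exists [ffun i => Ordinal (lt_M i)] => //.
  by apply/mnmP => i; rewrite mnmE ffunE.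
apply: sub_finite_set sub _; apply: finite_image; exact: finite_finset.
Qed.

(* Main.v *)
Require Import Defs.
From mathcomp Require Import all_boot all_order all_algebra.
From mathcomp Require Import boolp classical_sets functions cardinality.
From mathcomp Require Import mpoly.

Set Implicit Arguments.
Unset Strict Implicit.
Unset Printing Implicit Defensive.

Import GRing.Theory.

(** A monomial lies in a monomial ideal iff some generator divides it, so for
    [N >= 2] a spherical parking function is a vector [P] such that [x^P] is
    divisible by [m_{[N]} = prod_i x_i^{a_{i0}}] and by no other [m_A]. Since
    [d_A(i) - a_{i0}] is the number of edges from [i] to the non-root vertices
    outside [A], the vectors [P - (a_{i0})_i] depend only on the graph with its
    root deleted. Deleting the root from [K_{m+1,n}^{a,b}] and from
    [K_{n+1,m}^{a,b}] leaves the same graph, up to exchanging the two parts. *)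

Lemma mcoeffMX_eq0 (R : nzRingType) (N : nat) (p : {mpoly R[N]})
    (u v : 'X_{1..N}) :
  ~~ (u <= v)%MM -> ((p * 'X_[u])@_v = 0)%R.
Proof.
move=> nuv; rewrite mcoeffM big1 // => k /eqP def_v.
rewrite mcoeffX; case: eqP => [def_u|]; last by rewrite mulr0.
by case/negP: nuv; rewrite def_v def_u lem_addl.
Qed.

Lemma gen_ideal_mpolyX (R : comNzRingType) (N : nat) (I : finType)
    (P : pred I) (f : I -> 'X_{1..N}) (u : 'X_{1..N}) :
  gen_ideal P (fun i => 'X_[f i] : {mpoly R[N]}) 'X_[u] <->
  exists2 i, P i & (f i <= u)%MM.
Proof.
split=> [[c def_u] | [i Pi le_iu]].
  case: (boolP [exists i, P i && (f i <= u)%MM]).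
    by case/existsP=> i /andP[]; exists i.
  (* The coefficient of ['X_[u]] is 1 on the left, but 0 in every multiple of an ['X_[f i]] that
     does not divide ['X_[u]]. *)
  move/existsPn => nle; have := congr1 (mcoeff u) def_u.
  rewrite mcoeffX eqxx raddf_sum big1 => [/eqP|i Pi]; first by rewrite oner_eq0.
  by apply: mcoeffMX_eq0; have := nle i; rewrite Pi.
exists (fun j => if j == i then 'X_[u - f i] else 0)%R.
rewrite (bigD1 i) //= eqxx big1 => [|j /andP[_ /negbTE->]]; last exact: mul0r.
by rewrite addr0 -mpolyXD submK.
Qed.

Lemma mAE (K : fieldType) (N : nat) (G : multigraph N) (A : {set 'I_N}) :
  mA K G A = 'X_[[multinom (if i \in A then dA G A i else 0) | i < N]].
Proof.
rewrite /mA mprodXnE; congr mpolyX; apply/mnmP => i.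
rewrite mnm_sumE mnmE.
under eq_bigr do rewrite mulmnE mnm1E.
case: ifP => [Ai|nAi]; last first.
  by rewrite big1 // => j Aj; case: eqP => // def_j; rewrite def_j nAi in Aj.
rewrite (bigD1 i) //= eqxx mul1n big1 ?addn0 // => j.
by case/andP=> _ /negbTE->.
Qed.

Lemma gen_ideal_mA (K : fieldType) (N : nat) (G : multigraph N)
    (P : pred {set 'I_N}) (u : 'X_{1..N}) :
  gen_ideal P (mA K G) 'X_[u] <->
  exists2 A, P A & forall i, i \in A -> dA G A i <= u i.
Proof.
have -> : mA K G = fun A : {set 'I_N} =>
    'X_[[multinom (if i \in A then dA G A i else 0) | i < N]].
  by apply/funext => A; exact: mAE.
rewrite gen_ideal_mpolyX; split=> -[A PA le_A]; exists A => //.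
  by move=> i Ai; have /mnm_lepP/(_ i) := le_A; rewrite mnmE Ai.
by apply/mnm_lepP => i; rewrite mnmE; case: ifP => // /le_A.
Qed.

(** The share of [dA] that survives deleting the root. *)
Definition dA_nonroot (N : nat) (G : multigraph N) (A : {set 'I_N}) (i : 'I_N) :=
  \sum_(j | j \notin A) G (vertex i) (vertex j).

Lemma dAE (N : nat) (G : multigraph N) (A : {set 'I_N}) (i : 'I_N) :
  dA G A i = G (vertex i) ord0 + dA_nonroot G A i.
Proof.
rewrite /dA big_mkcond big_ord_recl /= ifT; last first.
  by apply/imsetP => -[j _ /eqP]; rewrite (negbTE (neq_lift _ _)).
congr addn; rewrite /dA_nonroot [RHS]big_mkcond; apply: eq_bigr => j _.
by rewrite (mem_imset (f := @vertex N)) //; exact: lift_inj.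
Qed.

Lemma sPFP (K : fieldType) (N : nat) (G : multigraph N) (u : 'X_{1..N}) :
  2 <= N ->
  sPF K G u <->
  (forall i, G (vertex i) ord0 <= u i) /\
  (forall A : {set 'I_N}, A != finset.set0 -> #|A| < N ->
     exists2 i, i \in A & u i < G (vertex i) ord0 + dA_nonroot G A i).
Proof.
(* With truncated subtraction, [N - 2 + 1] is [N - 1] only because [2 <= N]; the bound then selects
   the proper subsets. *)
move=> N2; have cardA (A : {set 'I_N}) : (#|A| <= N - 2 + 1) = (#|A| < N).
  by rewrite addn1 -subSn // subSS subn1 -ltnS prednK // ltnW.
rewrite /sPF /ideal_M /ideal_Mk /=.
split=> [[/gen_ideal_mA[A A0 leA] /gen_ideal_mA nk] | [ge_root lt_A]].
  split=> [i | B B0 ltB].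
    (* A proper [A] whose generator divides the monomial would put it in the smaller ideal. *)
    suff AT : A = [set: 'I_N]%SET.
      by rewrite (leq_trans _ (leA i _)) ?AT ?inE ?dAE ?leq_addr.
    apply/eqP; rewrite eqEcard finset.subsetT cardsT card_ord leqNgt.
    by apply/negP => ltA; apply: nk; exists A; rewrite // A0 cardA.
  case: (boolP [exists i, (i \in B) && (u i < dA G B i)]).
    by case/existsP=> i /andP[Bi lti]; exists i; rewrite -?dAE.
  move/existsPn => nB; case: nk; exists B; rewrite ?B0 ?cardA // => i Bi.
  by have := nB i; rewrite Bi -leqNgt.
split; apply/gen_ideal_mA.
  exists [set: 'I_N]%SET; first by rewrite -card_gt0 cardsT card_ord ltnW.
  move=> i _; rewrite dAE /dA_nonroot big_pred0 ?addn0 // => j.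
  by rewrite inE.
case=> A /andP[A0]; rewrite cardA => ltA leA.
by have [i Ai] := lt_A A A0 ltA; rewrite ltnNge -dAE leA.
Qed.

Lemma dA_nonroot_iso (N : nat) (G H : multigraph N) (s : 'I_N -> 'I_N)
    (A : {set 'I_N}) (i : 'I_N) :
  bijective s ->
  (forall i j, H (vertex (s i)) (vertex (s j)) = G (vertex i) (vertex j)) ->
  dA_nonroot H (s @: A) (s i) = dA_nonroot G A i.
Proof.
move=> bij_s iso; rewrite /dA_nonroot (reindex s) /=; last exact: onW_bij.
by apply: eq_big => [j | j _]; rewrite ?iso // (mem_imset _ _ (bij_inj bij_s)).
Qed.

(** Both conditions of [sPFP] constrain only the excess of [u] over the root multiplicities, so the
    excess is carried along [s] and the root edges of [H] are added back. *)
Lemma sPF_iso (K : fieldType) (N : nat) (G H : multigraph N) (s t : 'I_N -> 'I_N)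
    (u : 'X_{1..N}) :
  2 <= N -> cancel s t -> cancel t s ->
  (forall i j, H (vertex (s i)) (vertex (s j)) = G (vertex i) (vertex j)) ->
  sPF K G u ->
  sPF K H [multinom u (t i) - G (vertex (t i)) ord0 + H (vertex i) ord0 | i < N].
Proof.
move=> N2 sK tK iso /(sPFP K _ _ N2) [ge_root lt_A].
apply/(sPFP K _ _ N2); split=> [i | A A0 ltA]; first by rewrite mnmE leq_addl.
have bij_s : bijective s by exists t.
have defA : A = s @: (t @: A).
  by rewrite -imset_comp -[LHS]imset_id; apply: eq_imset => i; rewrite /= tK.
(* The strict inequality for [A] in [H] comes from the one for its preimage [t @: A] in [G]. *)
have [||i /imsetP[j Aj ->] lti] := lt_A (t @: A).
- by apply: contraNneq A0 => tA0; rewrite defA tA0 imset0.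
- by rewrite card_imset //; exact: can_inj tK.
exists j; rewrite // mnmE addnC ltn_add2l.
(* [ge_root] makes the truncated subtraction exact. *)
rewrite -(ltn_add2l (G (vertex (t j)) ord0)) subnKC //.
by rewrite -(dA_nonroot_iso _ _ bij_s iso) tK -defA in lti.
Qed.

(** [N] and [N'] are kept apart because [m + n] and [n + m] are not convertible; the bijection
    forces them equal. *)
Theorem sPF_card_eq_del_root (K : fieldType) (N N' : nat)
    (G : multigraph N) (H : multigraph N') (s : 'I_N -> 'I_N') :
  2 <= N -> bijective s ->
  (forall i j, H (vertex (s i)) (vertex (s j)) = G (vertex i) (vertex j)) ->
  (sPF K G #= sPF K H)%card.
Proof.
move=> N2 bij_s; have := bij_eq_card bij_s; rewrite !card_ord => eqN.
subst N'; have [t sK tK] := bij_s => iso.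
have iso' i j : G (vertex (t i)) (vertex (t j)) = H (vertex i) (vertex j).
  by rewrite -iso !tK.
pose shift (G1 G2 : multigraph N) (r : 'I_N -> 'I_N) (u : 'X_{1..N}) :=
  [multinom u (r i) - G1 (vertex (r i)) ord0 + G2 (vertex i) ord0 | i < N].
(* On [sPF K G1] the subtraction loses nothing, so the opposite shift undoes it. *)
have shiftK (G1 G2 : multigraph N) r1 r2 u : cancel r1 r2 -> sPF K G1 u ->
    shift G2 G1 r1 (shift G1 G2 r2 u) = u.
  move=> rK /(sPFP K _ _ N2)[ge_root _]; apply/mnmP => i.
  by rewrite !mnmE rK addnK subnK.
suff <- : [set shift G H t u | u in sPF K G]%classic = sPF K H.
  rewrite card_eq_sym; apply: inj_card_eq => u v; rewrite !inE => Gu Gv eq_uv.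
  by rewrite -(shiftK G H s t u) // eq_uv shiftK.
apply/seteqP; split=> [_ [u Gu <-] | v Hv]; first exact: (sPF_iso N2 sK tK iso).
exists (shift H G s v); first exact: (sPF_iso N2 tK sK iso').
exact: shiftK.
Qed.

Definition swap_parts (m n : nat) (i : 'I_(m + n)) : 'I_(n + m) :=
  unsplit (match fintype.split i with inl j => inr j | inr j => inl j end).

Lemma swap_partsK (m n : nat) :
  cancel (@swap_parts m n) (@swap_parts n m).
Proof.
move=> i; rewrite /swap_parts unsplitK -[RHS]splitK.
by case: (fintype.split i).
Qed.

(** Index [i] is vertex [i + 1], so [i < m] says that it shares the root's part; the swap reverses
    this. *)
Lemma ltn_swap_parts (m n : nat) (i : 'I_(m + n)) :
  (swap_parts i < n) = ~~ (i < m).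
Proof.
rewrite /swap_parts; case: (splitP i) => j _ /=; last exact: ltn_ord.
by rewrite ltnNge leq_addr.
Qed.

Theorem proposition3p3 (K : fieldType) (m n : nat) (hm : 1 <= m) (hn : 1 <= n) :
  (sPF K (complete_bipartite m n) #= sPF K (complete_bipartite n m))%card /\
  (forall a b : nat, 1 <= a -> 1 <= b ->
    (sPF K (complete_bipartite_multi m n a b) #=
     sPF K (complete_bipartite_multi n m a b))%card).
Proof.
have N2 : 2 <= m + n by rewrite (leq_add hm hn).
have bij_s : bijective (@swap_parts m n).
  by exists (@swap_parts n m); exact: swap_partsK.
(* The swap negates both part tests, so adjacency is kept, and edges off the root all have the same
   multiplicity (1 or [b]) in both graphs. *)
split=> [|a b _ _]; apply: (sPF_card_eq_del_root K N2 bij_s) => i j /=.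
  by rewrite /bip_adj !lift0 !ltn_swap_parts; case: (i < m); case: (j < m).
by rewrite /bip_mult !lift0 !ltn_swap_parts; case: (i < m); case: (j < m).
Qed.
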